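(* Let $\beta>0$, $\nu\in(0,1)$, and let $\{\xi^k\}$ be the sequence generated by the dual-primal algorithm described in the context. Let $$\mathcal H=\begin{pmatrix}\frac1\nu I_m&\frac1\nu I_m&0\\\frac1\nu I_m&\frac2\nu I_m&0\\0&0&I_m\end{pmatrix},\qquad \mathcal G=\begin{pmatrix}(1-\nu)I_m&0&0\\0&(1-\nu)I_m&0\\0&0&I_m\end{pmatrix}.$$ Then $$\|\xi^{k+1}-\xi^*\|_{\mathcal H}^2\le\|\xi^k-\xi^*\|_{\mathcal H}^2-\|\xi^k-\tilde\xi^k\|_{\mathcal G}^2\qquad\forall\,\xi^*\in\Xi^*,$$ and thus the sequence $\{\xi^k\}$ converges to some $\xi^*\in\Xi^*$.
   Context: Problem: $\min\{\theta_1(x)+\theta_2(y)\mid Ax+By=b\ (\text{or }\ge b),\ x\in\mathcal X,\ y\in\mathcal Y\}$, where $\theta_i:\mathbb R^{n_i}\to\mathbb R$ ($i=1,2$) are closed proper convex functions (not necessarily smooth), $\mathcal X\subseteq\mathbb R^{n_1}$, $\mathcal Y\subseteq\mathbb R^{n_2}$ are closed convex sets, $A\in\mathbb R^{m\times n_1}$, $B\in\mathbb R^{m\times n_2}$, $b\in\mathbb R^m$. Put $\Lambda=\mathbb R^m$ in the equality case and $\Lambda=\mathbb R^m_+$ in the inequality case, and $\Omega=\mathcal X\times\mathcal Y\times\Lambda$. Write $w=(x,y,\lambda)$, $u=(x,y)$, $\theta(u)=\theta_1(x)+\theta_2(y)$, $F(w)=(-A^T\lambda,\,-B^T\lambda,\,Ax+By-b)$.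 $\Omega^*$ is the set of all $w^*\in\Omega$ with $\theta(u)-\theta(u^* )+(w-w^* )^TF(w^* )\ge0$ for all $w\in\Omega$. Standing assumption: $\Omega^*\ne\emptyset$. Let $P=\mathrm{diag}(\sqrt\beta A,\sqrt\beta B,\tfrac1{\sqrt\beta}I_m)$ and $\Xi^*=\{Pw^*\mid w^*\in\Omega^*\}\subseteq\mathbb R^{3m}$. $\|v\|_{\mathcal H}^2=v^T\mathcal Hv$. Dual-primal algorithm. The iterates are triples of $m$-vectors $(a^k,c^k,\lambda^k)$, where $a^k$ stands for ''$Ax^k$'' and $c^k$ for ''$By^k$'' (these are treated as aggregate vectors in $\mathbb R^m$). Given $(a^k,c^k,\lambda^k)$: 1. Prediction: find $\tilde w^k=(\tilde x^k,\tilde y^k,\tilde\lambda^k)$ with $\tilde\lambda^k=\arg\max\{-\lambda^T(a^k+c^k-b)-\frac1{2\beta}\|\lambda-\lambda^k\|^2\mid\lambda\in\Lambda\}$, $\tilde x^k\in\arg\min\{\theta_1(x)-x^TA^T\tilde\lambda^k+\frac\beta2\|Ax-a^k\|^2\mid x\in\mathcal X\}$, $\tilde y^k\in\arg\min\{\theta_2(y)-y^TB^T\tilde\lambda^k+\frac\beta2\|(By-c^k)+(A\tilde x^k-a^k)\|^2\mid y\in\mathcal Y\}$. 2. Correction: $$\begin{pmatrix}a^{k+1}\\c^{k+1}\\\lambda^{k+1}\end{pmatrix}=\begin{pmatrix}a^k\\c^k\\\lambda^k\end{pmatrix}-\begin{pmatrix}\nu I_m&-\nu I_m&0\\0&\nu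 I_m&0\\-\beta I_m&-\beta I_m&I_m\end{pmatrix}\begin{pmatrix}a^k-A\tilde x^k\\c^k-B\tilde y^k\\\lambda^k-\tilde\lambda^k\end{pmatrix}.$$ The subproblem solutions are assumed to exist, so that the sequence is generated. Set $\xi^k=(\sqrt\beta a^k,\sqrt\beta c^k,\frac1{\sqrt\beta}\lambda^k)$ and $\tilde\xi^k=P\tilde w^k=(\sqrt\beta A\tilde x^k,\sqrt\beta B\tilde y^k,\frac1{\sqrt\beta}\tilde\lambda^k)$.
   Formalization: The subproblem solutions are assumed to exist for every input triple (a,c,λ), not only at the iterates of the given run; with existence only along one run the limit can fall outside Ξ* (since AX need not be closed). *)

(* Defs.v *)
From HB Require Import structures.
From mathcomp Require Import all_boot all_order all_algebra.
From mathcomp Require Import all_classical all_reals all_analysis.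
Import Order.TTheory GRing.Theory Num.Theory.
Import numFieldNormedType.Exports.

Set Implicit Arguments.
Unset Strict Implicit.
Unset Printing Implicit Defensive.

Local Open Scope classical_set_scope.
Local Open Scope ring_scope.

Definition dotv (R : realType) (n : nat) (u v : 'cV[R]_n) : R :=
  (u^T *m v) 0 0.

(* The squared (semi)norm v^T H v. *)
Definition sqnorm (R : realType) (n : nat) (H : 'M[R]_n) (v : 'cV[R]_n) : R :=
  dotv v (H *m v).

Definition argmin (R : realType) (T : Type) (D : set T) (f : T -> R) : set T :=
  [set x | D x /\ forall y, D y -> f x <= f y].

Definition argmax (R : realType) (T : Type) (D : set T) (f : T -> R) : set T :=
  [set x | D x /\ forall y, D y -> f y <= f x].

Definition col3 (R : realType) (p q r : nat)
    (x : 'cV[R]_p) (y : 'cV[R]_q) (z : 'cV[R]_r) : 'cV[R]_(p + q + r) :=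
  col_mx (col_mx x y) z.

(* The 3 x 3 block matrix with the given blocks, listed row by row. *)
Definition block3 (R : realType) (p q r p' q' r' : nat)
    (M11 : 'M[R]_(p, p')) (M12 : 'M[R]_(p, q')) (M13 : 'M[R]_(p, r'))
    (M21 : 'M[R]_(q, p')) (M22 : 'M[R]_(q, q')) (M23 : 'M[R]_(q, r'))
    (M31 : 'M[R]_(r, p')) (M32 : 'M[R]_(r, q')) (M33 : 'M[R]_(r, r')) :
    'M[R]_(p + q + r, p' + q' + r') :=
  block_mx (block_mx M11 M12 M21 M22) (col_mx M13 M23)
           (row_mx M31 M32)           M33.

(* Finite-valued functions are automatically proper; "closed" means lower
   semicontinuous. *)
Definition closed_proper_convex (R : realType) (n : nat)
    (f : 'cV[R]_n -> R) : Prop :=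
  convex_function setT f /\ lower_semicontinuous (EFin \o f).

Variant constraint_kind := EqualityConstraint | InequalityConstraint.

(* min theta1 x + theta2 y  subject to  A x + B y = b  (or >= b),
   x in X, y in Y. *)
Record problem (R : realType) (n1 n2 m : nat) := Problem {
  theta1 : 'cV[R]_n1 -> R;
  theta2 : 'cV[R]_n2 -> R;
  calX : set 'cV[R]_n1;
  calY : set 'cV[R]_n2;
  mxA : 'M[R]_(m, n1);
  mxB : 'M[R]_(m, n2);
  rhs : 'cV[R]_m;
  kind : constraint_kind }.

Definition convex_problem (R : realType) (n1 n2 m : nat)
    (pb : problem R n1 n2 m) : Prop :=
  [/\ closed_proper_convex (theta1 pb),
      closed_proper_convex (theta2 pb),
      closed (calX pb) /\ convex_set (calX pb) &
      closed (calY pb) /\ convex_set (calY pb)].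

Definition Lambda (R : realType) (n1 n2 m : nat) (pb : problem R n1 n2 m) :
    set 'cV[R]_m :=
  match kind pb with
  | EqualityConstraint => setT
  | InequalityConstraint => [set l | forall i, 0 <= l i 0]
  end.

Definition primal_dual (R : realType) (n1 n2 m : nat) : Type :=
  ('cV[R]_n1 * 'cV[R]_n2 * 'cV[R]_m)%type.

Definition Omega (R : realType) (n1 n2 m : nat) (pb : problem R n1 n2 m) :
    set (primal_dual R n1 n2 m) :=
  calX pb `*` calY pb `*` Lambda pb.

Definition vec (R : realType) (n1 n2 m : nat) (w : primal_dual R n1 n2 m) :
    'cV[R]_(n1 + n2 + m) :=
  col3 w.1.1 w.1.2 w.2.

Definition theta (R : realType) (n1 n2 m : nat) (pb : problem R n1 n2 m)
    (u : 'cV[R]_n1 * 'cV[R]_n2) : R :=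
  theta1 pb u.1 + theta2 pb u.2.

Definition opF (R : realType) (n1 n2 m : nat) (pb : problem R n1 n2 m)
    (w : primal_dual R n1 n2 m) : 'cV[R]_(n1 + n2 + m) :=
  col3 (- ((mxA pb)^T *m w.2))
       (- ((mxB pb)^T *m w.2))
       (mxA pb *m w.1.1 + mxB pb *m w.1.2 - rhs pb).

Definition Omega_star (R : realType) (n1 n2 m : nat) (pb : problem R n1 n2 m) :
    set (primal_dual R n1 n2 m) :=
  [set ws | Omega pb ws /\ forall w, Omega pb w ->
     0 <= theta pb w.1 - theta pb ws.1 + dotv (vec w - vec ws) (opF pb ws)].

Definition mxP (R : realType) (n1 n2 m : nat) (pb : problem R n1 n2 m)
    (beta : R) : 'M[R]_(m + m + m, n1 + n2 + m) :=
  block3 (Num.sqrt beta *: mxA pb) 0                         0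
         0                         (Num.sqrt beta *: mxB pb) 0
         0                         0                         (Num.sqrt beta)^-1%:M.

Definition Xi_star (R : realType) (n1 n2 m : nat) (pb : problem R n1 n2 m)
    (beta : R) : set 'cV[R]_(m + m + m) :=
  [set mxP pb beta *m vec ws | ws in Omega_star pb].

(* The prediction step: w = (x~, y~, lambda~) is a possible output on the
   input (a, c, l). *)
Definition prediction (R : realType) (n1 n2 m : nat) (pb : problem R n1 n2 m)
    (beta : R) (a c l : 'cV[R]_m) (w : primal_dual R n1 n2 m) : Prop :=
  let A := mxA pb in
  let B := mxB pb in
  let: (xt, yt, lt) := w in
  [/\ argmax (Lambda pb) (fun l' =>
        - dotv l' (a + c - rhs pb)
        - (2 * beta)^-1 * dotv (l' - l) (l' - l)) lt,
      argmin (calX pb) (fun x =>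
        theta1 pb x - dotv x (A^T *m lt)
        + beta / 2 * dotv (A *m x - a) (A *m x - a)) xt &
      argmin (calY pb) (fun y =>
        theta2 pb y - dotv y (B^T *m lt)
        + beta / 2 * dotv ((B *m y - c) + (A *m xt - a))
                          ((B *m y - c) + (A *m xt - a))) yt].

(* Solvability of the prediction subproblems is a property of the algorithm:
   it is required for every input of the prediction step, and not only for
   the iterates of one particular run. As A X and B Y need not be closed,
   solvability along a single run would not prevent that run from converging
   to a point outside Xi_star. *)
Definition subproblems_solvable (R : realType) (n1 n2 m : nat)
    (pb : problem R n1 n2 m) (beta : R) : Prop :=
  forall a c l : 'cV[R]_m, exists w, prediction pb beta a c l w.

Definition mxM (R : realType) (m : nat) (beta nu : R) : 'M[R]_(m + m + m) :=
  block3 (nu%:M      : 'M[R]_m) (- (nu%:M)) 0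
         0                   nu%:M       0
         (- (beta%:M))       (- (beta%:M)) 1%:M.

Definition correction (R : realType) (n1 n2 m : nat) (pb : problem R n1 n2 m)
    (beta nu : R) (a c l : 'cV[R]_m) (w : primal_dual R n1 n2 m) :
    'cV[R]_(m + m + m) :=
  col3 a c l
  - mxM m beta nu *m col3 (a - mxA pb *m w.1.1) (c - mxB pb *m w.1.2) (l - w.2).

Definition dual_primal_sequence (R : realType) (n1 n2 m : nat)
    (pb : problem R n1 n2 m) (beta nu : R)
    (a c l : nat -> 'cV[R]_m) (wt : nat -> primal_dual R n1 n2 m) : Prop :=
  forall k,
    prediction pb beta (a k) (c k) (l k) (wt k) /\
    col3 (a k.+1) (c k.+1) (l k.+1) =
      correction pb beta nu (a k) (c k) (l k) (wt k).

Definition mxH (R : realType) (m : nat) (nu : R) : 'M[R]_(m + m + m) :=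
  block3 ((1 / nu)%:M : 'M[R]_m) (1 / nu)%:M 0
         (1 / nu)%:M          (2 / nu)%:M 0
         0                    0           1%:M.

Definition mxG (R : realType) (m : nat) (nu : R) : 'M[R]_(m + m + m) :=
  block3 ((1 - nu)%:M : 'M[R]_m) 0           0
         0                    (1 - nu)%:M 0
         0                    0           1%:M.

Definition xi (R : realType) (m : nat) (beta : R) (a c l : nat -> 'cV[R]_m)
    (k : nat) : 'cV[R]_(m + m + m) :=
  col3 (Num.sqrt beta *: a k) (Num.sqrt beta *: c k) ((Num.sqrt beta)^-1 *: l k).

Definition xi_tilde (R : realType) (n1 n2 m : nat) (pb : problem R n1 n2 m)
    (beta : R) (wt : nat -> primal_dual R n1 n2 m) (k : nat) :
    'cV[R]_(m + m + m) :=
  mxP pb beta *m vec (wt k).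

(* Main.v *)
Require Import Defs.
From HB Require Import structures.
From mathcomp Require Import all_boot all_order all_algebra.
From mathcomp Require Import all_classical all_reals all_analysis.
From mathcomp Require Import ring lra.
Import Order.TTheory GRing.Theory Num.Theory.
Import numFieldNormedType.Exports.

Set Implicit Arguments.
Unset Strict Implicit.
Unset Printing Implicit Defensive.

Local Open Scope classical_set_scope.
Local Open Scope ring_scope.

(** The optimality conditions of the three subproblems add up to a variational
    inequality for the prediction, with defect [Q (xi - xi~)], where
    [Q = [[1,0,0],[1,1,0],[-1,-1,1]]].  In the variable [xi] the correction is
    [xi - M (xi - xi~)] with [H M = Q], and [Q + Q^T - M^T H M = G]; testing the
    inequality at a solution, where the skew-symmetric operator [F] contributes
    nothing, gives the contraction.  Hence [xi] is bounded and [xi - xi~] tends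
    to 0.  Since [Q + Q^T] is positive definite, the map from inputs to
    predictions is Lipschitz, so every cluster point is a fixed point of the
    prediction step and thus lies in [Xi*]; Fejer monotonicity then gives
    convergence of the whole sequence. *)

(** * Inner products, block vectors, and convergence and clustering in coordinates *)

Section InnerProduct.
Context {R : realType}.

Lemma dotvE n (u v : 'cV[R]_n) : dotv u v = \sum_i u i 0 * v i 0.
Proof. by rewrite /dotv mxE; apply: eq_bigr => i _; rewrite mxE. Qed.

Lemma dotvC n (u v : 'cV[R]_n) : dotv u v = dotv v u.
Proof. by rewrite !dotvE; apply: eq_bigr => i _; rewrite mulrC. Qed.

Lemma dotvDl n (u v w : 'cV[R]_n) : dotv (u + v) w = dotv u w + dotv v w.
Proof. by rewrite /dotv linearD mulmxDl mxE. Qed.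

Lemma dotvDr n (u v w : 'cV[R]_n) : dotv u (v + w) = dotv u v + dotv u w.
Proof. by rewrite /dotv mulmxDr mxE. Qed.

Lemma dotvNl n (u v : 'cV[R]_n) : dotv (- u) v = - dotv u v.
Proof. by rewrite /dotv linearN mulNmx mxE. Qed.

Lemma dotvNr n (u v : 'cV[R]_n) : dotv u (- v) = - dotv u v.
Proof. by rewrite /dotv mulmxN mxE. Qed.

Lemma dotvZl n t (u v : 'cV[R]_n) : dotv (t *: u) v = t * dotv u v.
Proof. by rewrite /dotv linearZ /= -scalemxAl mxE. Qed.

Lemma dotvZr n t (u v : 'cV[R]_n) : dotv u (t *: v) = t * dotv u v.
Proof. by rewrite /dotv -scalemxAr mxE. Qed.

Definition dotv_lin := (dotvDl, dotvDr, dotvNl, dotvNr, dotvZl, dotvZr).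

Lemma dotv_mull p n (A : 'M[R]_(n, p)) (u : 'cV[R]_p) (v : 'cV[R]_n) :
  dotv (A *m u) v = dotv u (A^T *m v).
Proof. by rewrite /dotv trmx_mul mulmxA. Qed.

Lemma dotv_ge0 n (u : 'cV[R]_n) : 0 <= dotv u u.
Proof. by rewrite dotvE sumr_ge0// => i _; rewrite -expr2 sqr_ge0. Qed.

Lemma sqr_coord_le_dotv n (u : 'cV[R]_n) i : u i 0 ^+ 2 <= dotv u u.
Proof.
rewrite dotvE (bigD1 i)//= -expr2 lerDl sumr_ge0// => j _.
by rewrite -expr2 sqr_ge0.
Qed.

Lemma dotv_le0_eq0 n (u : 'cV[R]_n) : dotv u u <= 0 -> u = 0.
Proof.
move=> u0; apply/colP => i; rewrite mxE; apply/eqP.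
by rewrite -sqrf_eq0 eq_le sqr_ge0 andbT (le_trans (sqr_coord_le_dotv u i)).
Qed.

Lemma dotv_col3 p q r (x x' : 'cV[R]_p) (y y' : 'cV[R]_q) (z z' : 'cV[R]_r) :
  dotv (col3 x y z) (col3 x' y' z') = dotv x x' + dotv y y' + dotv z z'.
Proof. by rewrite /dotv /col3 !tr_col_mx !mul_row_col !mxE. Qed.

Lemma col3B p q r (x x' : 'cV[R]_p) (y y' : 'cV[R]_q) (z z' : 'cV[R]_r) :
  col3 x y z - col3 x' y' z' = col3 (x - x') (y - y') (z - z').
Proof. by rewrite /col3 !opp_col_mx !add_col_mx. Qed.

Lemma eq_col3 p q r (x x' : 'cV[R]_p) (y y' : 'cV[R]_q) (z z' : 'cV[R]_r) :
  col3 x y z = col3 x' y' z' -> [/\ x = x', y = y' & z = z'].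
Proof. by move=> /eq_col_mx[/eq_col_mx[-> ->] ->]. Qed.

Lemma col3_surj p q r (v : 'cV[R]_(p + q + r)) :
  exists x y z, v = col3 x y z.
Proof.
exists (usubmx (usubmx v)), (dsubmx (usubmx v)), (dsubmx v).
by rewrite /col3 !vsubmxK.
Qed.

Lemma mul_block3_col3 p q r p' q' r'
    (M11 : 'M[R]_(p, p')) (M12 : 'M[R]_(p, q')) (M13 : 'M[R]_(p, r'))
    (M21 : 'M[R]_(q, p')) (M22 : 'M[R]_(q, q')) (M23 : 'M[R]_(q, r'))
    (M31 : 'M[R]_(r, p')) (M32 : 'M[R]_(r, q')) (M33 : 'M[R]_(r, r'))
    (x : 'cV[R]_p') (y : 'cV[R]_q') (z : 'cV[R]_r') :
  block3 M11 M12 M13 M21 M22 M23 M31 M32 M33 *m col3 x y z =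
  col3 (M11 *m x + M12 *m y + M13 *m z)
       (M21 *m x + M22 *m y + M23 *m z)
       (M31 *m x + M32 *m y + M33 *m z).
Proof.
by rewrite /block3 /col3 !mul_block_col mul_col_mx mul_row_col !add_col_mx.
Qed.

Lemma dotv_cvg n (u : nat -> 'cV[R]_n) (v : 'cV[R]_n) :
  (forall e, 0 < e -> exists N, forall k, (N <= k)%N ->
     dotv (u k - v) (u k - v) < e) ->
  u k @[k --> \oo] --> v.
Proof.
move=> uv; apply/cvg_ballP => e e0.
have [N uN] := uv _ (exprn_gt0 2 e0).
exists N => // k /= /uN uk; split=> // i j; rewrite ord1.
rewrite /ball/= -ltr_sqr ?nnegrE ?normr_ge0 ?ltW// real_normK ?num_real//.
apply: le_lt_trans uk; apply: le_trans (sqr_coord_le_dotv _ i).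
by rewrite !mxE -sqrrN opprB.
Qed.

Lemma dotv_bounded_cluster n (u : nat -> 'cV[R]_n) (M : R) :
  (forall k, dotv (u k) (u k) <= M) ->
  exists v, forall e, 0 < e -> forall N, exists2 k, (N <= k)%N &
    dotv (u k - v) (u k - v) < e.
Proof.
move=> uM.
have M0 : 0 <= M := le_trans (dotv_ge0 (u 0%N)) (uM 0%N).
(* A square at most [M] forces an absolute value at most [M + 1], so this box contains the
   sequence. *)
have Mco : compact [set v : 'rV[R]_n | forall i,
    `[- (M + 1), M + 1]%classic (v ord0 i)].
  by apply: (@rV_compact _ _ (fun=> _)) => i; exact: segment_compact.
have uMF : ((fun k => (u k)^T) @ \oo) [set v : 'rV[R]_n | forall i,
    `[- (M + 1), M + 1]%classic (v ord0 i)].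
  exists 0%N => // k _ i; rewrite /= in_itv/= -ler_norml mxE.
  have := le_trans (sqr_coord_le_dotv (u k) i) (uM k).
  rewrite -real_normK ?num_real//; have := normr_ge0 (u k i 0).
  by move: (`|_|) => x; nra.
have [w [_ wcl]] := Mco _ _ uMF.
exists w^T => e e0 N.
(* Coordinates within [d <= 1] have squares at most [d], and [n] of these add up to less than [e];
   [n + 1] keeps the quotient defined for [n = 0]. *)
pose d := Num.min 1 (e / (n%:R + 1)).
have n1 : 0 < n%:R + 1 :> R by rewrite ltr_wpDl// ler0n.
have d0 : 0 < d by rewrite lt_min ltr01 divr_gt0.
have [_ [[k Nk <-] wk]] := wcl ((fun k => (u k)^T) @` [set k | (N <= k)%N])
  (ball w d) (ex_intro2 _ _ N I (fun k Nk => ex_intro2 _ _ k Nk erefl))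
  (nbhsx_ballx w d d0).
exists k => //; rewrite dotvE.
apply: (@le_lt_trans _ _ (\sum_(i < n) d)).
  apply: ler_sum => i _; have [_ /(_ 0 i)] := wk.
  rewrite /ball/= !mxE => wk'.
  have d1 : d <= 1 by rewrite ge_min lexx.
  have -> : u k i 0 - w 0 i = - (w 0 i - u k i 0) by ring.
  rewrite mulrNN -expr2 -real_normK ?num_real//.
  by move: wk' (normr_ge0 (w 0 i - u k i 0)); move: (`|_|) => x; nra.
rewrite sumr_const card_ord -mulr_natl.
have : d <= e / (n%:R + 1) by rewrite ge_min lexx orbT.
rewrite ler_pdivlMr// => de; apply: lt_le_trans de.
by rewrite mulrDr mulr1 mulrC ltrDl.
Qed.

End InnerProduct.

(** * First-order optimality from convexity *)

(** The linear term dominates for small [t]: if [a < 0], the point [t = - a / (b - a)] already makes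
    the sum negative. *)
Lemma ge0_linear_quadratic (R : realFieldType) (a b : R) : 0 <= b ->
  (forall t, 0 < t -> t <= 1 -> 0 <= t * a + t ^+ 2 * b) -> 0 <= a.
Proof.
move=> b0 ab; rewrite leNgt; apply/negP => a0.
have ba0 : 0 < b - a by lra.
have t0 : 0 < - a / (b - a) by rewrite divr_gt0// oppr_gt0.
have t1 : - a / (b - a) <= 1 by rewrite ler_pdivrMr//; lra.
have := ab _ t0 t1.
have -> : - a / (b - a) * a + (- a / (b - a)) ^+ 2 * b =
    - a * (a / (b - a)) ^+ 2 * -1.
  by field; lra.
suff : 0 < - a * (a / (b - a)) ^+ 2 by lra.
by rewrite mulr_gt0 ?oppr_gt0// exprn_even_gt0//= mulf_neq0 ?invr_eq0; lra.
Qed.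

Section Optimality.
Context {R : realType}.

(* First-order optimality for a convex function plus a linear and a quadratic
   term: compare the minimizer with the points of a segment that starts at it. *)
Lemma argmin_variational n m (D : set 'cV[R]_n) (f J : 'cV[R]_n -> R)
    (g : 'cV[R]_n) (K : 'M[R]_(m, n)) (h : 'cV[R]_m) (b : R) (x : 'cV[R]_n) :
  convex_function setT f -> convex_set D -> 0 <= b ->
  (forall y, J y = f y - dotv y g + b / 2 * dotv (K *m y - h) (K *m y - h)) ->
  argmin D J x ->
  forall y, D y ->
    0 <= f y - f x - dotv (y - x) g + b * dotv (K *m y - K *m x) (K *m x - h).
Proof.
move=> cf cD b0 JE [Dx xmin] y Dy.
(* Along the segment, [J] grows by at most [t] times the claimed quantity plus [t ^+ 2] times this
   coefficient. *)
apply: (@ge0_linear_quadratic _ _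
    (b / 2 * dotv (K *m y - K *m x) (K *m y - K *m x))) => [|t t0 t1].
  by rewrite mulr_ge0 ?dotv_ge0// divr_ge0.
pose t01 := Itv01 (ltW t0) t1.
have Dz : D (t *: y + (1 - t) *: x).
  by have := cD y x t01 (mem_set Dy) (mem_set Dx); rewrite inE.
have fz : f (t *: y + (1 - t) *: x) <= t * f y + (1 - t) * f x.
  by apply: (cf t01 y x); rewrite inE.
have := xmin _ Dz; rewrite !JE.
have -> : K *m (t *: y + (1 - t) *: x) - h =
    t *: (K *m y - K *m x) + (K *m x - h).
  rewrite mulmxDr -!scalemxAr; move: (K *m y) (K *m x) => p q.
  by apply/colP => i; rewrite !mxE; ring.
move: (K *m y - K *m x) (K *m x - h) => p q.
rewrite !dotv_lin (dotvC q p); move: fz.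
move: (f _) (f y) (f x) (dotv p p) (dotv p q) (dotv q q) (dotv y g) (dotv x g).
by move=> *; lra.
Qed.

End Optimality.

(** * The matrices [Q], [M], [H], [G] and their quadratic forms *)

Section Matrices.
Context {R : realType}.
Variables (m : nat) (nu : R).

(** Second row: the [y]-subproblem also sees the residual of [x]. Third row: the multiplier is
    predicted from [a + c], whereas [F] is evaluated at the predicted [x] and [y]. *)
Definition mxQ : 'M[R]_(m + m + m) :=
  block3 (1%:M : 'M[R]_m) 0         0
         1%:M          1%:M      0
         (- (1%:M))      (- (1%:M))  1%:M.

(* The correction matrix read in the variable [xi]. *)
Definition mxMxi : 'M[R]_(m + m + m) :=
  block3 (nu%:M : 'M[R]_m) (- (nu%:M)) 0
         0              nu%:M     0
         (- (1%:M))       (- (1%:M))  1%:M.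

Let mulE := (@mul_block3_col3 R, @mulNmx R, @mul_scalar_mx R, @mul0mx R,
  @scale1r R, @addr0 'cV[R]_m, @add0r 'cV[R]_m).

Lemma dotv_mxQ (x y z x' y' z' : 'cV[R]_m) :
  dotv (col3 x y z) (mxQ *m col3 x' y' z') =
  dotv x x' + dotv y (x' + y') + dotv z (z' - x' - y').
Proof.
rewrite /mxQ !mulE dotv_col3; congr (_ + dotv z _).
by rewrite addrC addrA.
Qed.

(** Twice the form equals [dotv v v] plus the squared norm of [x + y - z]. *)
Lemma mxQ_coercive (v : 'cV[R]_(m + m + m)) :
  2^-1 * dotv v v <= dotv v (mxQ *m v).
Proof.
have [x [y [z ->]]] := col3_surj v; rewrite dotv_mxQ dotv_col3.
have := dotv_ge0 (x + y - z).
rewrite !dotv_lin (dotvC z x) (dotvC z y) (dotvC y x).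
by move=> *; lra.
Qed.

Lemma mxQ_bounded (v : 'cV[R]_(m + m + m)) :
  dotv (mxQ *m v) (mxQ *m v) <= 6 * dotv v v.
Proof.
have [x [y [z ->]]] := col3_surj v.
rewrite /mxQ !mulE !dotv_col3.
have := dotv_ge0 (x - y); have := dotv_ge0 (x + z); have := dotv_ge0 (y + z).
have := dotv_ge0 x; have := dotv_ge0 y; have := dotv_ge0 z.
rewrite !dotv_lin (dotvC z x) (dotvC z y) (dotvC y x).
by move=> *; lra.
Qed.

Lemma mxH_sym (u v : 'cV[R]_(m + m + m)) :
  dotv u (mxH m nu *m v) = dotv v (mxH m nu *m u).
Proof.
have [x [y [z ->]]] := col3_surj u; have [x' [y' [z' ->]]] := col3_surj v.
rewrite /mxH !mulE !dotv_col3 !dotv_lin.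
rewrite (dotvC x' x) (dotvC x' y) (dotvC y' x) (dotvC y' y) (dotvC z' z).
by ring.
Qed.

Lemma sqnorm_mxH (x y z : 'cV[R]_m) :
  sqnorm (mxH m nu) (col3 x y z) =
  nu^-1 * (dotv (x + y) (x + y) + dotv y y) + dotv z z.
Proof.
rewrite /sqnorm /mxH !mulE !dotv_col3 !dotv_lin (dotvC y x).
by rewrite mul1r; ring.
Qed.

Lemma sqnorm_mxG (x y z : 'cV[R]_m) :
  sqnorm (mxG m nu) (col3 x y z) =
  (1 - nu) * (dotv x x + dotv y y) + dotv z z.
Proof. by rewrite /sqnorm /mxG !mulE !dotv_col3 !dotv_lin mulrDr. Qed.

Hypotheses (nu_gt0 : 0 < nu) (nu_lt1 : nu < 1).

Lemma mxH_mxMxi (v : 'cV[R]_(m + m + m)) : mxH m nu *m (mxMxi *m v) = mxQ *m v.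
Proof.
have [x [y [z ->]]] := col3_surj v; rewrite /mxH /mxMxi /mxQ !mulE.
have nu0 : nu != 0 by rewrite gt_eqF.
by congr col3; apply/colP => i; rewrite !mxE; field.
Qed.

(** Since [H M = Q], this is the identity [G = Q + Q^T - M^T H M] read as quadratic forms. *)
Lemma mxG_mxMxi (v : 'cV[R]_(m + m + m)) :
  dotv (mxMxi *m v) (mxQ *m v) = 2 * dotv v (mxQ *m v) - sqnorm (mxG m nu) v.
Proof.
have [x [y [z ->]]] := col3_surj v; rewrite sqnorm_mxG dotv_mxQ.
rewrite /mxMxi /mxQ !mulE dotv_col3 !dotv_lin.
by rewrite (dotvC z x) (dotvC z y) (dotvC y x); ring.
Qed.

(** The block [[[1,1],[1,2]]] has eigenvalues [(3 - sqrt 5)/2] and [(3 + sqrt 5)/2], which lie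
    between 1/3 and 3; this gives the constant 3 here and in the upper bound. *)
Lemma sqnorm_mxH_lower (v : 'cV[R]_(m + m + m)) :
  dotv v v <= 3 * sqnorm (mxH m nu) v.
Proof.
have [x [y [z ->]]] := col3_surj v; rewrite sqnorm_mxH dotv_col3.
have nu1 : 1 <= nu^-1 by rewrite -invr1 lef_pV2 ?posrE ?ltW.
have h : dotv (x + y) (x + y) + dotv y y <=
    nu^-1 * (dotv (x + y) (x + y) + dotv y y).
  by rewrite ler_peMl// addr_ge0 ?dotv_ge0.
have := dotv_ge0 (x + 2 *: y); have := dotv_ge0 x; have := dotv_ge0 z.
have := dotv_ge0 (x + y + y); have := dotv_ge0 (x + y).
move: h; move: (nu^-1 * _) => t.
rewrite !dotv_lin (dotvC y x) => *.
by nra.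
Qed.

Lemma sqnorm_mxH_upper (v : 'cV[R]_(m + m + m)) :
  sqnorm (mxH m nu) v <= 3 / nu * dotv v v.
Proof.
have [x [y [z ->]]] := col3_surj v; rewrite sqnorm_mxH dotv_col3.
have nu1 : 1 <= nu^-1 by rewrite -invr1 lef_pV2 ?posrE ?ltW.
have h : nu^-1 * (dotv (x + y) (x + y) + dotv y y) <=
    nu^-1 * (3 * (dotv x x + dotv y y)).
  apply: ler_wpM2l; first by lra.
  have := dotv_ge0 (x - y); have := dotv_ge0 x.
  by rewrite !dotv_lin (dotvC y x) => *; lra.
apply: le_trans (lerD h (lexx _)) _.
have zz : dotv z z <= nu^-1 * dotv z z by rewrite ler_peMl// dotv_ge0.
have z0 : 0 <= nu^-1 * dotv z z := le_trans (dotv_ge0 z) zz.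
by move: (dotv x x) (dotv y y) (dotv z z) zz z0 => s t r *; lra.
Qed.

Lemma sqnorm_mxG_lower (v : 'cV[R]_(m + m + m)) :
  (1 - nu) * dotv v v <= sqnorm (mxG m nu) v.
Proof.
have [x [y [z ->]]] := col3_surj v; rewrite sqnorm_mxG dotv_col3.
by have := mulr_ge0 (ltW nu_gt0) (dotv_ge0 z); lra.
Qed.

(* The algebra behind the contraction: with [H M = Q] and [G = Q + Q^T - M^T H M],
   moving from [u] to [u - M (u - ut)] changes the squared [H]-distance to [s] by
   [- 2 (ut - s)^T Q (u - ut) - |u - ut|_G^2]. *)
Lemma sqnorm_mxH_correction (u ut s : 'cV[R]_(m + m + m)) :
  sqnorm (mxH m nu) (u - mxMxi *m (u - ut) - s) =
  sqnorm (mxH m nu) (u - s) - sqnorm (mxG m nu) (u - ut)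
  - 2 * dotv (ut - s) (mxQ *m (u - ut)).
Proof.
have -> : u - mxMxi *m (u - ut) - s = (u - s) - mxMxi *m (u - ut).
  by rewrite addrAC.
have -> : ut - s = (u - s) - (u - ut).
  by apply/colP => i; rewrite !mxE; ring.
move: (u - s) (u - ut) => e d.
rewrite /sqnorm mulmxBr mxH_mxMxi !dotv_lin.
by rewrite (mxH_sym (_ *m _) e) mxH_mxMxi mxG_mxMxi /sqnorm; ring.
Qed.

End Matrices.

(** * Convergence of Fejer monotone sequences *)

Section FejerMonotone.
Context {R : realType}.

(** Once a value is within [e] of the infimum, all later values are squeezed between the two. *)
Lemma nonincreasing_ge0_drop (N : nat -> R) :
  (forall k, N k.+1 <= N k) -> (forall k, 0 <= N k) ->
  forall e, 0 < e -> exists K, forall k, (K <= k)%N -> N k - N k.+1 < e.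
Proof.
move=> Nnincr N0 e e0.
have hN : has_inf (range N).
  by split; [exists (N 0%N), 0%N|exists 0 => _ [k _ <-]].
have [_ [K _ <-] NK] := inf_adherent e0 hN.
exists K => k Kk.
have le_Nk : N k <= N K.
  by elim: k Kk => [|k ih]; [rewrite leqn0 => /eqP ->|
    rewrite leq_eqVlt => /predU1P[->//|/ih]; exact: le_trans].
have : inf (range N) <= N k.+1 by apply: ge_inf; [exact: hN.2|exists k.+1].
by lra.
Qed.

(* A sequence that is Fejer monotone with respect to [S] has a cluster point;
   if this point lies in [S], the distance to it is nonincreasing along the
   sequence and gets arbitrarily small. *)
Lemma Fejer_cvg n (q : 'cV[R]_n -> R) (al be g : R) (S : set 'cV[R]_n)
    (u ut : nat -> 'cV[R]_n) :
  0 < al -> 0 < be -> 0 < g ->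
  (forall v, dotv v v <= al * q v) -> (forall v, q v <= be * dotv v v) ->
  S !=set0 ->
  (forall k s, S s ->
     q (u k.+1 - s) <= q (u k - s) - g * dotv (u k - ut k) (u k - ut k)) ->
  (forall v, (forall e, 0 < e -> exists2 k,
      dotv (u k - v) (u k - v) < e & dotv (u k - ut k) (u k - ut k) < e) ->
    S v) ->
  exists2 v, S v & u k @[k --> \oo] --> v.
Proof.
move=> al0 be0 g0 q_lower q_upper [s Ss] fejer clusterS.
have q_ge0 v : 0 <= q v.
  by rewrite -(pmulr_rge0 _ al0) (le_trans (dotv_ge0 v)).
have q_decr k s' : S s' -> q (u k.+1 - s') <= q (u k - s').
  move=> /(fejer k) /le_trans; apply.
  by rewrite gerBl mulr_ge0 ?dotv_ge0// ltW.
have q_nincr k K s' : S s' -> (K <= k)%N -> q (u k - s') <= q (u K - s').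
  move=> Ss'; elim: k => [|k ih]; first by rewrite leqn0 => /eqP ->.
  rewrite leq_eqVlt => /predU1P[->//|/ih]; apply: le_trans; exact: q_decr.
have step0 e : 0 < e -> exists K, forall k, (K <= k)%N ->
    dotv (u k - ut k) (u k - ut k) < e.
  move=> e0.
  have [K qK] := nonincreasing_ge0_drop (fun k => q_decr k s Ss)
    (fun k => q_ge0 _) (mulr_gt0 g0 e0).
  exists K => k /qK /= qk; have fk := fejer k s Ss.
  by rewrite -(ltr_pM2l g0); lra.
have u_bounded k : dotv (u k - s) (u k - s) <= al * q (u 0%N - s).
  apply: le_trans (q_lower _) _; rewrite ler_pM2l//; exact: q_nincr.
(* The bounded sequence is [u - s], so the cluster point of [u] is [w + s]. *)
have [w wcl] := dotv_bounded_cluster u_bounded.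
have Sv : S (w + s).
  apply: clusterS => e e0; have [K uK] := step0 _ e0.
  have [k /uK ? wk] := wcl _ e0 K; exists k => //.
  by rewrite (addrC w) opprD addrA.
exists (w + s) => //; apply: dotv_cvg => e e0.
have ab0 : 0 < al * be by rewrite mulr_gt0.
(* Passing to [q] and back costs the factor [al * be]. One close index suffices, since [q] of the
   distance does not increase afterwards. *)
have [K _ wK] := wcl _ (divr_gt0 e0 ab0) 0%N.
exists K => k Kk.
apply: le_lt_trans (q_lower _) _.
apply: (@le_lt_trans _ _ (al * q (u K - (w + s)))).
  by rewrite ler_pM2l//; exact: q_nincr.
apply: (@le_lt_trans _ _ (al * (be * dotv (u K - s - w) (u K - s - w)))).
  by rewrite ler_pM2l// (addrC w) opprD addrA.
by rewrite mulrA mulrC -ltr_pdivlMr.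
Qed.

End FejerMonotone.

(** * The prediction step as a variational inequality *)

Section Prediction.
Context {R : realType}.
Variables (n1 n2 m : nat) (pb : problem R n1 n2 m) (beta : R).

(** The left side of the inequality defining [Omega_star], with base point [w] and test point
    [w']. *)
Definition gap (w w' : primal_dual R n1 n2 m) : R :=
  theta pb w'.1 - theta pb w.1 + dotv (vec w' - vec w) (opF pb w).

(* [opF pb] is affine with a skew-symmetric linear part. *)
Lemma gap_skew w w' : gap w w' + gap w' w = 0.
Proof.
case: w w' => [[x y] l] [[x' y'] l']; rewrite /gap /vec /opF /=.
rewrite !col3B !dotv_col3 !dotvNr -!dotv_mull !mulmxBr !dotv_lin.
rewrite !(dotvC l) !(dotvC l').
by ring.
Qed.

Definition scale3 (a c l : 'cV[R]_m) : 'cV[R]_(m + m + m) :=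
  col3 (Num.sqrt beta *: a) (Num.sqrt beta *: c) ((Num.sqrt beta)^-1 *: l).

Lemma scale3B a c l a' c' l' :
  scale3 a c l - scale3 a' c' l' = scale3 (a - a') (c - c') (l - l').
Proof. by rewrite /scale3 col3B -!scalerBr. Qed.

Lemma mxP_vec w :
  mxP pb beta *m vec w = scale3 (mxA pb *m w.1.1) (mxB pb *m w.1.2) w.2.
Proof.
rewrite /mxP /vec mul_block3_col3 !mul0mx !(addr0, add0r).
by rewrite -!scalemxAl mul_scalar_mx.
Qed.

Hypothesis beta_gt0 : 0 < beta.

(** Lets the prediction step start from any vector in the [xi] variable, in particular from a
    cluster point. *)
Lemma scale3_surj v : exists a c l, v = scale3 a c l.
Proof.
have s0 : Num.sqrt beta != 0 by rewrite gt_eqF// sqrtr_gt0.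
have [x [y [z ->]]] := col3_surj v.
exists ((Num.sqrt beta)^-1 *: x), ((Num.sqrt beta)^-1 *: y), (Num.sqrt beta *: z).
by rewrite /scale3 !scalerA mulVf// mulfV// !scale1r.
Qed.

Lemma dotv_mxQ_scale3 a c l a' c' l' :
  dotv (scale3 a c l) (mxQ m *m scale3 a' c' l') =
  beta * dotv a a' + beta * dotv c (a' + c')
  + dotv l (beta^-1 *: l' - a' - c').
Proof.
have s0 : Num.sqrt beta != 0 by rewrite gt_eqF// sqrtr_gt0.
rewrite /scale3 dotv_mxQ; move: (sqr_sqrtr (ltW beta_gt0)) s0.
move: (Num.sqrt beta) => s <- s0; rewrite !dotv_lin.
by field.
Qed.

Lemma Lambda_convex : convex_set (Lambda pb).
Proof.
rewrite /Lambda; case: (kind pb) => x y t; rewrite !inE// => x0 y0 i.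
rewrite !mxE addr_ge0// mulr_ge0//.
by rewrite subr_ge0.
Qed.

Lemma prediction_variational a c l w : convex_problem pb ->
  prediction pb beta a c l w -> Omega pb w /\
  forall w', Omega pb w' ->
    let xit := mxP pb beta *m vec w in
    dotv (mxP pb beta *m vec w' - xit) (mxQ m *m (scale3 a c l - xit)) <=
    gap w w'.
Proof.
case: w => [[x y] lt] [[cf1 _] [cf2 _] [_ cX] [_ cY]] [lmax xmin ymin].
split; first by split; [split; [case: xmin|case: ymin]|case: lmax].
move=> [[x' y'] l'] [[/= Xx' Yy'] Ll'].
have b2 : 0 <= beta := ltW beta_gt0.
have vx := argmin_variational cf1 cX b2 (fun=> erefl) xmin Xx'.
(* The quadratic term in [y] is centred at [c - (A x - a)]. *)
have vy : 0 <= theta2 pb y' - theta2 pb y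
    - dotv (y' - y) ((mxB pb)^T *m lt)
    + beta * dotv (mxB pb *m y' - mxB pb *m y)
        (mxB pb *m y - (c - (mxA pb *m x - a))).
  apply: (argmin_variational cf2 cY b2 _ ymin Yy') => z.
  have -> : mxB pb *m z - (c - (mxA pb *m x - a)) =
      mxB pb *m z - c + (mxA pb *m x - a).
    by rewrite opprB [LHS]addrA [RHS]addrAC.
  by [].
(* The maximization is negated into a minimization with zero convex part and identity matrix. *)
have vl : 0 <= 0 - 0 - dotv (l' - lt) (- (a + c - rhs pb))
    + beta^-1 * dotv (1%:M *m l' - 1%:M *m lt) (1%:M *m lt - l).
  apply: (@argmin_variational _ _ _ (Lambda pb) (fun=> 0)
    (fun z => dotv z (a + c - rhs pb) + (2 * beta)^-1 * dotv (z - l) (z - l))).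
  - by move=> t u v _ _; rewrite convmm.
  - exact: Lambda_convex.
  - by rewrite invr_ge0.
  - by move=> z; rewrite mul1mx dotvNr sub0r opprK invfM [2^-1 * _]mulrC.
  - case: lmax => Ll lmax; split=> // z /lmax; lra.
  - exact: Ll'.
rewrite /= !mxP_vec !scale3B dotv_mxQ_scale3 /gap /vec /opF /theta /=.
move: vx vy vl; rewrite !mul1mx -!dotv_mull !col3B !dotv_col3.
rewrite !dotvNr -!dotv_mull !mulmxBr.
move: (mxA pb *m x) (mxA pb *m x') (mxB pb *m y) (mxB pb *m y') => p p' q q'.
rewrite !dotv_lin => *.
by lra.
Qed.

End Prediction.

(** * Contraction, stability of the prediction, and cluster points *)

Section DualPrimal.
Context {R : realType}.
Variables (n1 n2 m : nat) (pb : problem R n1 n2 m) (beta nu : R).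
Hypotheses (pb_convex : convex_problem pb) (beta_gt0 : 0 < beta).

(** The scaling by [sqrt beta] and its inverse absorbs the [beta] in the last row of [mxM]. *)
Lemma xi_correction (a c l : nat -> 'cV[R]_m)
    (wt : nat -> primal_dual R n1 n2 m) k :
  col3 (a k.+1) (c k.+1) (l k.+1) =
    correction pb beta nu (a k) (c k) (l k) (wt k) ->
  xi beta a c l k.+1 = xi beta a c l k
    - mxMxi m nu *m (xi beta a c l k - xi_tilde pb beta wt k).
Proof.
have s0 : Num.sqrt beta != 0 by rewrite gt_eqF// sqrtr_gt0.
rewrite /correction /mxM /xi_tilde mxP_vec mul_block3_col3 col3B.
move=> /eq_col3[aE cE lE]; rewrite /xi aE cE lE /scale3 col3B.
rewrite /mxMxi mul_block3_col3 col3B.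
rewrite !mulNmx !mul_scalar_mx !mul0mx !scale1r.
move: (a k) (c k) (l k) (mxA pb *m _) (mxB pb *m _) ((wt k).2).
move=> x y z x' y' z'; move: (sqr_sqrtr (ltW beta_gt0)) s0.
move: (Num.sqrt beta) => s <- s0.
by congr col3; apply/colP => i; rewrite !mxE; field.
Qed.

(** Optimality gives [0 <= gap ws w], so [gap w ws <= 0] by skew symmetry, and this bounds the
    inequality of the prediction tested at [ws]. *)
Lemma prediction_contraction a c l w ws :
  prediction pb beta a c l w -> Omega_star pb ws ->
  let xit := mxP pb beta *m vec w in
  0 <= dotv (xit - mxP pb beta *m vec ws) (mxQ m *m (scale3 beta a c l - xit)).
Proof.
move=> wpred [Ows optws] /=.
have [Ow /(_ _ Ows) /=] := prediction_variational beta_gt0 pb_convex wpred.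
have : 0 <= gap pb ws w := optws _ Ow.
rewrite -(opprB _ (mxP _ _ *m vec w)) dotvNl.
by have := gap_skew pb w ws; lra.
Qed.

(* Each variational inequality is tested at the other prediction; by skew
   symmetry the two gaps cancel, which leaves [z^T Q (z + e) <= 0]. *)
Lemma prediction_lipschitz a c l w a' c' l' w' :
  prediction pb beta a c l w -> prediction pb beta a' c' l' w' ->
  let e := scale3 beta a c l - scale3 beta a' c' l' in
  let z := mxP pb beta *m vec w' - mxP pb beta *m vec w in
  dotv z z <= 24 * dotv e e.
Proof.
move=> wpred wpred' /=; set z := _ - _; set e := _ - _.
have [Ow vw] := prediction_variational beta_gt0 pb_convex wpred.
have [Ow' vw'] := prediction_variational beta_gt0 pb_convex wpred'.
have := gap_skew pb w w'; have := vw' _ Ow; have := vw _ Ow' => /=.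
rewrite -(opprB (mxP _ _ *m vec w')) dotvNl -/z.
have -> : scale3 beta a c l - mxP pb beta *m vec w =
    z + e + (scale3 beta a' c' l' - mxP pb beta *m vec w').
  by apply/colP => i; rewrite /z /e !mxE; ring.
clearbody z e; rewrite 2!mulmxDr !dotvDr.
(* Coercivity gives [|z|^2 / 2 <= - z^T Q e], the square gives [- z^T Q e <= |z|^2 / 4 + |Q e|^2],
   and [|Q e|^2 <= 6 |e|^2]; hence 24. *)
have := mxQ_coercive z; have := mxQ_bounded e.
have := dotv_ge0 (z + 2 *: (mxQ m *m e)).
rewrite !dotv_lin (dotvC _ z).
by move=> *; lra.
Qed.

Lemma prediction_fixed_point a c l w :
  prediction pb beta a c l w -> scale3 beta a c l = mxP pb beta *m vec w ->
  Omega_star pb w.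
Proof.
move=> wpred aE; have [Ow vw] := prediction_variational beta_gt0 pb_convex wpred.
split=> // w' /vw /=.
by rewrite aE subrr mulmx0 {1}/dotv mulmx0 mxE.
Qed.

(* The prediction started from the cluster point [v] is compared with the
   predictions along the sequence; this is where solvability is needed at an
   input that is not an iterate. *)
Lemma Xi_star_cluster (u ut : nat -> 'cV[R]_(m + m + m)) v :
  subproblems_solvable pb beta ->
  (forall k, exists a c l w, [/\ prediction pb beta a c l w,
     u k = scale3 beta a c l & ut k = mxP pb beta *m vec w]) ->
  (forall e, 0 < e -> exists2 k, dotv (u k - v) (u k - v) < e &
     dotv (u k - ut k) (u k - ut k) < e) ->
  Xi_star pb beta v.
Proof.
move=> solvable pred clv.
have [a [c [l vE]]] := scale3_surj beta_gt0 v.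
have [w wpred] := solvable a c l.
suff v0 : v - mxP pb beta *m vec w = 0.
  have vw : v = mxP pb beta *m vec w by apply/eqP; rewrite -subr_eq0 v0.
  exists w => //; apply: prediction_fixed_point wpred _.
  by rewrite -vE.
apply: dotv_le0_eq0; rewrite leNgt; apply/negP.
set r := v - _ => r0.
(* Here [78 = 3 * (1 + 1 + 24)]: [r] splits into three vectors, and the third is controlled by the
   Lipschitz constant 24. *)
have [|k uv uut] := clv (78^-1 * dotv r r); first by rewrite mulr_gt0.
have [ak [ck [lk [wk [wkpred ukE utkE]]]]] := pred k.
have := prediction_lipschitz wkpred wpred; rewrite /= -ukE -vE -utkE.
set z := _ - ut k.
have rE : r = (u k - ut k) - (u k - v) - z.
  by apply/colP => i; rewrite /r /z !mxE; ring.
move: uv uut rE; move: (u k - v) (u k - ut k) z => e d z ev dv rE zv.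
have : dotv r r <= 3 * (dotv d d + dotv e e + dotv z z).
  have := dotv_ge0 (d + e); have := dotv_ge0 (d + z); have := dotv_ge0 (e - z).
  by rewrite rE !dotv_lin (dotvC z d) (dotvC z e) (dotvC e d) => *; lra.
by lra.
Qed.

End DualPrimal.

Theorem theorem5p1 (R : realType) (n1 n2 m : nat) (pb : problem R n1 n2 m)
    (beta nu : R) (a c l : nat -> 'cV[R]_m)
    (wt : nat -> primal_dual R n1 n2 m)
    (pb_convex : convex_problem pb)
    (solution_exists : Omega_star pb !=set0)
    (beta_gt0 : 0 < beta) (nu_gt0 : 0 < nu) (nu_lt1 : nu < 1)
    (solvable : subproblems_solvable pb beta)
    (generated : dual_primal_sequence pb beta nu a c l wt) :
  (forall (k : nat) (xis : 'cV[R]_(m + m + m)), Xi_star pb beta xis ->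
     sqnorm (mxH m nu) (xi beta a c l k.+1 - xis) <=
       sqnorm (mxH m nu) (xi beta a c l k - xis)
       - sqnorm (mxG m nu) (xi beta a c l k - xi_tilde pb beta wt k)) /\
  (exists2 xis : 'cV[R]_(m + m + m), Xi_star pb beta xis &
     xi beta a c l k @[k --> \oo] --> xis).
Proof.
have contraction k xis : Xi_star pb beta xis ->
    sqnorm (mxH m nu) (xi beta a c l k.+1 - xis) <=
    sqnorm (mxH m nu) (xi beta a c l k - xis)
    - sqnorm (mxG m nu) (xi beta a c l k - xi_tilde pb beta wt k).
  move=> [ws ows <-]; have [wpred step] := generated k.
  rewrite (xi_correction beta_gt0 step) sqnorm_mxH_correction//.
  rewrite gerBl mulr_ge0//.
  exact: (prediction_contraction pb_convex beta_gt0 wpred ows).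
split=> //.
(* The constants 3 and [3 / nu] compare the [H]-norm with the Euclidean one; [1 - nu] bounds [G]
   from below. *)
apply: (@Fejer_cvg _ _ (sqnorm (mxH m nu)) 3 (3 / nu) (1 - nu) _ _
  (xi_tilde pb beta wt)) => //.
- by rewrite divr_gt0.
- by rewrite subr_gt0.
- exact: sqnorm_mxH_lower.
- exact: sqnorm_mxH_upper.
- by have [ws ows] := solution_exists; exists (mxP pb beta *m vec ws), ws.
- move=> k s /(contraction k) /le_trans; apply.
  by rewrite lerD2l lerN2; exact: sqnorm_mxG_lower.
- move=> v; apply: (Xi_star_cluster pb_convex beta_gt0 solvable) => k.
  exists (a k), (c k), (l k), (wt k); split=> //.
  by have [] := generated k.
Qed.
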